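(* Let $A$ and $B$ be linear differential operators on $\mathbb R^d$. If $A$ is a differential pre-transmutation of $B$ and if $B$ satisfies the weak unique continuation property, then $A$ satisfies the weak unique continuation property.
   Context: Let $d,n,m,p,q\in\mathbb N^*$. A linear differential operator on $\mathbb R^d$ is a finite-order linear differential operator $\sum_{|\alpha|\le k}C_\alpha(x)\partial^\alpha$ with $C^\infty$ matrix-valued coefficients on $\mathbb R^d$. Here $A:\mathcal E\to\mathcal F$, $B:\mathcal G\to\mathcal H$ with $\mathcal E=C^\infty(\mathbb R^d;\mathbb R^n)$, $\mathcal F=C^\infty(\mathbb R^d;\mathbb R^m)$, $\mathcal G=C^\infty(\mathbb R^d;\mathbb R^p)$, $\mathcal H=C^\infty(\mathbb R^d;\mathbb R^q)$. Such operators also act on (vector-valued) smooth functions on any open subset of $\mathbb R^d$. $A$ is a differential pre-transmutation of $B$ if there are linear differential operators with $C^\infty$ coefficients $P:\mathcal G\to\mathcal E$, $Q:\mathcal E\to\mathcal G$, $S:\mathcal F\to\mathcal H$, $T:\mathcal F\to\mathcal E$ such that $BQ=SA$ and $PQ+TA=\mathrm{Id}_{\mathcal E}$. A linear differential operator $A$ satisfies the weak unique continuation property if for any non-empty open subset $\tilde\Omega$ of $\mathbb R^d$, for any non-empty open subset $\Omega$ of $\tilde\Omega$, and for any smooth function $u$ defined on $\tilde\Omega$ satisfying $Au=0$ in $\tilde\Omega$ and $u=0$ in $\Omega$, one has $u=0$ in $\tilde\Omega$. *)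

(* Defs.v *)
From mathcomp Require Import all_boot all_order all_algebra.
From mathcomp Require Import all_classical all_reals all_analysis.

Set Implicit Arguments.
Unset Strict Implicit.
Unset Printing Implicit Defensive.

Import Order.TTheory GRing.Theory Num.Theory.
Import numFieldNormedType.Exports.

Local Open Scope classical_set_scope.
Local Open Scope ring_scope.

(* Points of R^d are row vectors, values of functions are column vectors.
   A function on an open set O of R^d is represented by a total function whose
   values outside O are irrelevant: a partial derivative at a point of the open
   set O depends only on the values of the function near that point. *)

Section Smooth.
Context {R : realType} {d : nat} {V : normedModType R}.
Implicit Types (f : 'rV[R]_d -> V) (O : set 'rV[R]_d).

Definition partial (i : 'I_d) f : 'rV[R]_d -> V := 'D_(delta_mx 0 i) f.

Definition partials (s : seq 'I_d) f : 'rV[R]_d -> V := foldr partial f s.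

(* C^oo on O, meant for open O: all iterated partial derivatives, of any order
   and in any order of differentiation, exist and are continuous at every point
   of O. *)
Definition smooth_on O f : Prop :=
  forall (s : seq 'I_d) (x : 'rV[R]_d), O x ->
    {for x, continuous (partials s f)} /\
    forall i : 'I_d, derivable (partials s f) x (delta_mx 0 i).

(* \partial^alpha, with the partial derivatives composed in the order of the
   coordinates. *)
Definition partial_multi (alpha : 'I_d -> nat) f : 'rV[R]_d -> V :=
  foldr (fun i g => iter (alpha i) (partial i) g) f (enum 'I_d).

End Smooth.

(* Linear differential operators C^oo(R^d; R^n) -> C^oo(R^d; R^m), given by
   their coefficients. A multi-index alpha with |alpha| <= k has all its entries
   at most k, hence the finite type below; the coefficients with |alpha| > k are
   not used. *)
Record ldo (R : realType) (d n m : nat) := Ldo {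
  ldo_order : nat;
  ldo_coef : {ffun 'I_d -> 'I_ldo_order.+1} -> 'rV[R]_d -> 'M[R]_(m, n);
  ldo_coef_smooth : forall alpha, smooth_on setT (ldo_coef alpha) }.

Definition ldo_apply (R : realType) (d n m : nat) (L : ldo R d n m)
    (u : 'rV[R]_d -> 'cV[R]_n) (x : 'rV[R]_d) : 'cV[R]_m :=
  \sum_(alpha : {ffun 'I_d -> 'I_(ldo_order L).+1}
         | (\sum_i alpha i <= ldo_order L)%N)
    ldo_coef alpha x *m partial_multi (fun i => alpha i) u x.

Coercion ldo_apply : ldo >-> Funclass.

Definition pre_transmutation (R : realType) (d n m p q : nat)
    (A : ldo R d n m) (B : ldo R d p q) : Prop :=
  exists (P : ldo R d p n) (Q : ldo R d n p) (S : ldo R d m q) (T : ldo R d m n),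
    (forall u : 'rV[R]_d -> 'cV[R]_n, smooth_on setT u ->
       forall x, B (Q u) x = S (A u) x) /\
    (forall u : 'rV[R]_d -> 'cV[R]_n, smooth_on setT u ->
       forall x, P (Q u) x + T (A u) x = u x).

Definition weak_ucp (R : realType) (d n m : nat) (A : ldo R d n m) : Prop :=
  forall (O' O : set 'rV[R]_d),
    open O' -> O' !=set0 -> open O -> O !=set0 -> O `<=` O' ->
  forall u : 'rV[R]_d -> 'cV[R]_n, smooth_on O' u ->
    (forall x, O' x -> A u x = 0) ->
    (forall x, O x -> u x = 0) ->
  forall x, O' x -> u x = 0.

(* Main.v *)
(* For an arbitrary smooth u on an open set O', the identities B Q = S A and
   P Q + T A = Id are only given for functions smooth on the whole space; they
   carry over to u because differential operators are local and u agrees near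
   each point of O' with a globally smooth function, namely u times a cutoff.
   So if A u = 0 on O' and u = 0 on O, then B (Q u) = S (A u) = 0 on O' and
   Q u = 0 on O; unique continuation for B gives Q u = 0 on O', and hence
   u = P (Q u) + T (A u) = 0 on O'. *)
Require Import Defs.
From mathcomp Require Import all_boot all_order all_algebra.
From mathcomp Require Import all_classical all_reals all_analysis.
From mathcomp Require Import ring lra.

Set Implicit Arguments.
Unset Strict Implicit.
Unset Printing Implicit Defensive.

Import Order.TTheory GRing.Theory Num.Theory.
Import numFieldNormedType.Exports.

Local Open Scope classical_set_scope.
Local Open Scope ring_scope.

(** Restriction to the line through [a] in direction [v] makes the one-variable chain rule
    available. *)
Lemma derive_line (R : numFieldType) (V W : normedModType R) (f : V -> W)
    (a v : V) : 'D_v f a = 'D_1 (fun h : R => f (h *: v + a)) 0.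
Proof.
rewrite /derive; set g1 := fun h => _; set g2 := fun h => _.
suff -> : g1 = g2 by [].
by apply/funext => h; rewrite /g1 /g2 /= addr0 scale0r add0r [_%:A]mulr1.
Qed.

(** * Calculus of functions smooth on an open set *)

Section Smoothness.
Context {R : realType} {d : nat}.
Implicit Types (O : set 'rV[R]_d) (x y : 'rV[R]_d) (i : 'I_d) (k : nat).

Section Codomain.
Context {V : normedModType R}.
Implicit Types f g : 'rV[R]_d -> V.

(** Equality near [x] also holds near every point close to [x], so it survives each
    differentiation. *)
Lemma partials_near s f g x :
  {near x, f =1 g} -> {near x, partials s f =1 partials s g}.
Proof.
move=> fg; elim: s => [//|i s IHs] /=.
apply: filterS (near_join IHs) => y; exact: near_eq_derive.
Qed.

Lemma partials_rcons s i f : partials (rcons s i) f = partials s (partial i f).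
Proof. by elim: s => //= j s ->. Qed.

(* Recursion on the innermost derivative, whereas [partials] peels off the
   outermost one. *)
Fixpoint smooth_upto k O f : Prop :=
  if k is k'.+1 then
    [/\ forall x, O x -> {for x, continuous f},
        forall x i, O x -> derivable f x (delta_mx 0 i)
      & forall i, smooth_upto k' O (partial i f)]
  else True.

Lemma smooth_onP O f : smooth_on O f <-> forall k, smooth_upto k O f.
Proof.
split=> [fO k|fO s x Ox].
  elim: k f fO => //= k IHk f fO; split.
  - by move=> x /(fO [::])[].
  - by move=> x i /(fO [::])[].
  - by move=> i; apply: IHk => s; rewrite -partials_rcons; exact: fO.
(* One order more than the length of [s]: once [s] is consumed, the remaining level gives continuity
   and derivability of [partials s f]. *)
have {fO} := fO (size s).+1.
elim/last_ind: s f => [|s i IHs] f; first by case=> ? ?; split; auto.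
by rewrite size_rcons partials_rcons => -[_ _ /(_ i)]; exact: IHs.
Qed.

Lemma smooth_uptoS k O f : smooth_upto k.+1 O f -> smooth_upto k O f.
Proof.
elim: k f => //= k IHk f [fc fd fp]; split=> // i.
exact: IHk (fp i).
Qed.

(** On an open set, equality is equality near each point. This lets a derivative be replaced by a
    formula valid on [O] only. *)
Lemma eq_smooth_upto k O f g : open O -> {in O, f =1 g} ->
  smooth_upto k O f -> smooth_upto k O g.
Proof.
move=> Oo; elim: k f g => //= k IHk f g fg [fc fd fp].
have near_fg x : O x -> {near x, f =1 g}.
  by move=> Ox; apply: filterS (open_nbhs_nbhs (conj Oo Ox)) => y /mem_set/fg.
split.
- move=> x Ox; rewrite /prop_for /continuous_at -fg ?inE//.
  exact: cvg_trans (near_eq_cvg (near_fg x Ox)) (fc x Ox).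
- by move=> x i Ox; exact: near_eq_derivable (near_fg x Ox) (fd x i Ox).
- move=> i; apply: IHk (fp i) => x; rewrite inE => Ox.
  exact/near_eq_derive/near_fg.
Qed.

Lemma smooth_upto_cst k O (c : V) : smooth_upto k O (fun=> c).
Proof.
elim: k c => //= k IHk c; split.
- by move=> x _; exact: cst_continuous.
- by move=> x i _; exact: (derivable_cst c).
- move=> i; rewrite (_ : partial i _ = fun=> 0)//.
  by apply/funext => x; exact: derive_cst.
Qed.

Lemma smooth_uptoD k O f g : open O ->
  smooth_upto k O f -> smooth_upto k O g -> smooth_upto k O (f \+ g).
Proof.
move=> Oo; elim: k f g => //= k IHk f g [fc fd fp] [gc gd gp]; split.
- by move=> x Ox; exact: (continuousD (fc x Ox) (gc x Ox)).
- by move=> x i Ox; apply: derivableD; auto.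
- move=> i; apply: eq_smooth_upto (IHk _ _ (fp i) (gp i)) => // x.
  by rewrite inE => Ox; rewrite /partial deriveD; auto.
Qed.

Lemma smooth_uptoN k O f : open O ->
  smooth_upto k O f -> smooth_upto k O (fun x => - f x).
Proof.
move=> Oo; elim: k f => //= k IHk f [fc fd fp]; split.
- by move=> x Ox; exact: (continuousN (fc x Ox)).
- by move=> x i Ox; apply: derivableN; auto.
- move=> i; apply: eq_smooth_upto (IHk _ (fp i)) => // x.
  by rewrite inE => Ox; rewrite /partial deriveN; auto.
Qed.

Lemma smooth_upto_sum k O (I : Type) (r : seq I) (P : pred I)
    (F : I -> 'rV[R]_d -> V) : open O ->
  (forall j, P j -> smooth_upto k O (F j)) ->
  smooth_upto k O (fun x => \sum_(j <- r | P j) F j x).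
Proof.
move=> Oo FO; elim: r => [|j r IHr].
  rewrite (_ : (fun=> _) = fun=> 0); first exact: smooth_upto_cst.
  by apply/funext => x; rewrite big_nil.
rewrite (_ : (fun=> _) = (if P j then F j else fun=> 0) \+
  (fun x => \sum_(j <- r | P j) F j x)).
  by apply: smooth_uptoD => //; case: ifPn => [/FO//|_]; exact: smooth_upto_cst.
by apply/funext => x /=; rewrite big_cons; case: ifP => //; rewrite add0r.
Qed.

End Codomain.

Implicit Types f g : 'rV[R]_d -> R^o.

(** The Leibniz rule keeps [f] and [g] undifferentiated; [smooth_uptoS] lowers them to the order of
    the induction hypothesis. *)
Lemma smooth_uptoM k O f g : open O ->
  smooth_upto k O f -> smooth_upto k O g ->
  smooth_upto k O (fun x => f x * g x : R^o).
Proof.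
move=> Oo; elim: k f g => //= k IHk f g fO gO.
have [fc fd fp] := fO; have [gc gd gp] := gO; split.
- by move=> x Ox; exact: (continuousM (fc x Ox) (gc x Ox)).
- by move=> x i Ox; apply: derivableM; auto.
- move=> i.
  have fk := smooth_uptoS (fO : smooth_upto k.+1 O f).
  have gk := smooth_uptoS (gO : smooth_upto k.+1 O g).
  have := smooth_uptoD Oo (IHk _ _ fk (gp i)) (IHk _ _ gk (fp i)).
  apply: eq_smooth_upto => // x.
  by rewrite inE => Ox; rewrite /partial deriveM; auto.
Qed.

(** The derivative [- f^-2 * partial i f] contains [f^-1] again, but only to the lower order
    supplied by induction. *)
Lemma smooth_uptoV k O f : open O -> (forall x, O x -> f x != 0) ->
  smooth_upto k O f -> smooth_upto k O (fun x => (f x)^-1 : R^o).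
Proof.
move=> Oo f0; elim: k f f0 => //= k IHk f f0 fO.
have [fc fd fp] := fO; split.
- by move=> x Ox; exact: (continuousV (f0 x Ox) (fc x Ox)).
- by move=> x i Ox; apply: derivableV; auto.
- move=> i.
  have fk := IHk _ f0 (smooth_uptoS (fO : smooth_upto k.+1 O f)).
  have := smooth_uptoM Oo (smooth_uptoM Oo fk fk)
    (smooth_uptoM Oo (smooth_upto_cst k O (-1 : R^o)) (fp i)).
  apply: eq_smooth_upto => // x.
  rewrite inE => Ox; rewrite /partial deriveV; [|exact: f0|exact: fd].
  by rewrite /GRing.scale/= -exprVn; ring.
Qed.

(* A family [H] closed under derivation stands for a smooth function of one
   variable together with its successive derivatives. *)
Lemma smooth_upto_comp (I : Type) (H : I -> R -> R) (D : I -> I) :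
  (forall a t, is_derive (t : R) 1 (H a) (H (D a) t)) ->
  forall k O f a, open O -> smooth_upto k O f ->
  smooth_upto k O (fun x => H a (f x) : R^o).
Proof.
move=> HD k O f a Oo; elim: k f a => //= k IHk f a fO.
have [fc fd fp] := fO.
have Hc b : continuous (H b : R -> R).
  by move=> t; apply/differentiable_continuous/derivable1_diffP; case: (HD b t).
(* One-variable chain rule for [f] restricted to the line through [x] in the [i]-th direction. *)
have chain x i : O x -> is_derive x (delta_mx 0 i) (fun x => H a (f x) : R^o)
    (H (D a) (f x) * partial i f x).
  move=> Ox.
  have fline : is_derive (0 : R) 1 (fun h : R => f (h *: delta_mx 0 i + x))
      (partial i f x).
    apply: DeriveDef; first exact: (derivable1P f x _).1 (fd x i Ox).
    by rewrite /partial (derive_line f).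
  have [cd cD] := @is_derive1_comp _ (H a) _ _ _ _ (HD a _) fline.
  apply: DeriveDef; first exact: (derivable1P _ x _).2 cd.
  by rewrite derive_line cD scale0r add0r.
split.
- by move=> x Ox; exact: (continuous_comp (fc x Ox) (Hc a (f x))).
- by move=> x i Ox; case: (chain x i Ox).
- move=> i.
  have fk := smooth_uptoS (fO : smooth_upto k.+1 O f).
  apply: eq_smooth_upto (smooth_uptoM Oo (IHk f (D a) fk) (fp i)) => // x.
  by rewrite inE => Ox; case: (chain x i Ox).
Qed.

Lemma smooth_upto_coord k O i : smooth_upto k O (fun x => x 0 i : R^o).
Proof.
case: k => //= k.
have did x j : derivable (@id 'rV[R]_d) x (delta_mx 0 j) by exact: derivable_id.
split.
- by move=> x _; exact: coord_continuous.
- by move=> x j _; exact: (derivable_mxP _ _ _).1 (did x j) 0 i.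
- move=> j; rewrite (_ : partial j _ = fun=> (delta_mx 0 j : 'rV[R]_d) 0 i).
    exact: smooth_upto_cst.
  apply/funext => x; have := derive_mx (did x j).
  by rewrite derive_id => /matrixP/(_ 0 i) ->; rewrite mxE.
Qed.

(** Derivatives of matrices are computed entrywise; this carries the scalar rules over to vector and
    matrix values. *)
Lemma smooth_upto_mxP k O m n (F : 'rV[R]_d -> 'M[R]_(m, n)) : open O ->
  smooth_upto k O F <-> forall a b, smooth_upto k O (fun x => F x a b : R^o).
Proof.
move=> Oo; elim: k F => [//|k IHk] F.
have dF i : (forall x, O x -> derivable F x (delta_mx 0 i)) ->
  forall a b, {in O, (fun x => partial i F x a b) =1
                    partial i (fun x => F x a b : R^o)}.
  move=> Fd a b x; rewrite inE => Ox.
  by rewrite /partial derive_mx ?mxE//; exact: Fd.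
split=> /=.
  move=> [Fc Fd Fp] a b; split.
  - move=> x Ox.
    exact: (continuous_comp (Fc x Ox) (@coord_continuous _ _ _ a b (F x))).
  - by move=> x i Ox; exact: (derivable_mxP _ _ _).1 (Fd x i Ox) a b.
  - move=> i; apply: eq_smooth_upto (dF i _ a b) _ => //; last first.
      by have /IHk := Fp i; exact.
    by move=> x; exact: Fd.
move=> FO.
have Fd x i : O x -> derivable F x (delta_mx 0 i).
  by move=> Ox; apply/derivable_mxP => a b; have [_ + _] := FO a b; exact.
split=> //.
- move=> x Ox A [P PF PA]; rewrite /= nbhs_simpl /=.
  (* A neighbourhood of a matrix contains a product of neighbourhoods of its entries, and finitely
     many such conditions hold jointly near [x]. *)
  pose PF' (ab : 'I_m * 'I_n) y := P ab.1 ab.2 (F y ab.1 ab.2).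
  have : \forall y \near x, forall ab, PF' ab y.
    apply: (@filter_forall _ _ PF' (nbhs x)) => ab.
    by have [/(_ x Ox) + _ _] := FO ab.1 ab.2; exact.
  by apply: filterS => y Py; apply: PA => a b; exact: (Py (a, b)).
- move=> i; apply/IHk => a b.
  have [_ _ /(_ i)] := FO a b.
  apply: eq_smooth_upto => // x Ox; rewrite dF// => y; exact: Fd.
Qed.

End Smoothness.

(** * The flat function exp(-1/t) and its derivatives *)

Section Flat.
Context {R : realType}.
Implicit Types (p : {poly R}) (s t : R).

(* Closed under derivation, by [is_derive_flat]: this is what makes
   [exp (- 1/t)] extended by [0] smooth at [0]. *)
Definition flat p t : R :=
  if 0 < t then p.[t^-1] * expR (- t^-1) else 0.

(** For s >= 0, the single term s^k / k! of the exponential series is at most exp s. *)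
Lemma exprn_expRN_le (k : nat) s : 0 <= s -> s ^+ k * expR (- s) <= k`!%:R.
Proof.
move=> s0; rewrite expRN ler_pdivrMr ?expR_gt0//.
case: k => [|k]; first by rewrite expr0 mul1r -expR0 ler_expR.
rewrite mulrC -ler_pdivrMr ?ltr0n ?fact_gt0//.
by apply: le_trans (expR_ge1Dxn k s0); rewrite lerDr.
Qed.

Lemma horner_expRN_bounded p : exists C : R,
  forall s, 0 <= s -> `|p.[s] * expR (- s)| <= C.
Proof.
(* The extra factor [s ^+ k] absorbs the ['X] split off in the Horner induction on [p]. *)
suff /(_ 0%N)[C HC] : forall k : nat, exists C : R,
    forall s, 0 <= s -> `|s ^+ k * p.[s] * expR (- s)| <= C.
  by exists C => s /HC; rewrite mul1r.
elim/poly_ind: p => [|p c IHp] k.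
  by exists 0 => s _; rewrite horner0 mulr0 mul0r normr0.
have [C HC] := IHp k.+1; exists (C + `|c| * k`!%:R) => s s0.
rewrite hornerMXaddC.
rewrite (_ : _ * _ = s ^+ k.+1 * p.[s] * expR (- s) +
  c * (s ^+ k * expR (- s))); last by rewrite exprS; ring.
rewrite (le_trans (ler_normD _ _))// lerD ?HC//.
rewrite normrM ler_wpM2l// ger0_norm ?exprn_expRN_le//.
by rewrite mulr_ge0 ?exprn_ge0 ?expR_ge0.
Qed.

Lemma flat_bounded p : exists2 C : R, 0 < C & forall t, `|flat p t| <= C.
Proof.
have [C HC] := horner_expRN_bounded p.
have C0 : 0 <= C by exact: le_trans (HC 0 _).
(* [C] may be [0]; the added [1] gives a bound that can be divided by. *)
exists (C + 1) => [|t]; first by rewrite ltr_wpDl.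
rewrite /flat; case: ifPn => [t0|_]; last by rewrite normr0 addr_ge0.
by rewrite (le_trans (HC _ _)) ?invr_ge0 ?ltW// ltrDl.
Qed.

(* The factor [t ^ 2] against a bounded function gives a zero derivative at [0]. *)
Lemma flat_factor p t : flat p t = t ^+ 2 * flat ('X^2 * p) t.
Proof.
rewrite /flat; case: ifPn => [t0|_]; last by rewrite mulr0.
rewrite hornerM hornerXn; field; exact: lt0r_neq0.
Qed.

(** For t > 0, p(1/t) exp(-1/t) has derivative t^-2 (p - p')(1/t) exp(-1/t), and t^-2 is the value
    of X^2 at 1/t. For t < 0 the function is locally zero; the point 0 needs a difference
    quotient. *)
Lemma is_derive_flat p t : is_derive t 1 (flat p) (flat ('X^2 * (p - p^`())) t).
Proof.
have [t0|t0|->] := ltgtP t 0.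
- rewrite {2}/flat ltNge (ltW t0) /=.
  have : is_derive t 1 (cst (0:R)) (0 : R) by exact: is_derive_cst.
  apply: near_eq_is_derive; near=> s.
  rewrite /flat ifN// -leNgt; near: s; exact: lt_le_nbhsl.
- have E : is_derive t 1 (fun s => p.[s^-1] * expR (- s^-1))
      (flat ('X^2 * (p - p^`())) t).
    have ti : is_derive t 1 (fun s => s^-1) (- t ^- 2).
      have := is_deriveV (lt0r_neq0 t0) (is_derive_id t 1).
      by rewrite [_ *: _]mulr1.
    have tN : is_derive t 1 (fun s => - s^-1) (- - t ^- 2) by exact: is_deriveN.
    have E1 : is_derive t 1 (fun s => p.[s^-1]) (p^`().[t^-1] * - t ^- 2).
      exact: (@is_derive1_comp _ (horner p) _ _ _ _ (is_derive_poly p _) ti).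
    have E2 : is_derive t 1 (fun s => expR (- s^-1))
        (expR (- t^-1) * - - t ^- 2).
      exact: (@is_derive1_comp _ expR _ _ _ _ (is_derive_expR _) tN).
    apply: (is_derive_eq (is_deriveM E1 E2)).
    rewrite /flat t0 !hornerE /GRing.scale/=; field.
    exact: lt0r_neq0.
  apply: near_eq_is_derive E; near=> s.
  rewrite /flat ifT//; near: s; exact: lt_nbhsr.
- rewrite {2}/flat ltxx.
  have [C C0 HC] := flat_bounded ('X^2 * p).
  have H : h^-1 *: ((flat p \o shift 0) (h *: 1) - flat p 0) @[h --> 0^'] -->
      (0 : R).
    apply/cvgrPdist_le => /= e e0; near=> h.
    have h0 : h != 0 by near: h; exact: nbhs_dnbhs_neq.
    (* By [flat_factor] the quotient is [h * flat ('X^2 * p) h], of absolute value at most |h| C,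
       hence at most e once |h| <= e / C. *)
    rewrite sub0r normrN {2}/flat ltxx subr0 addr0 [_%:A]mulr1 flat_factor.
    rewrite /GRing.scale/= mulrA expr2 mulKf// normrM.
    rewrite (@le_trans _ _ (`|h| * C))// ?ler_wpM2l// -ler_pdivlMr//.
    near: h; apply: dnbhs0_le; exact: divr_gt0.
  by apply: DeriveDef; [exact: cvgP H|exact: cvg_lim H].
Unshelve. all: by end_near. Qed.
End Flat.

Lemma flat1_ge0 (R : realType) (t : R) : 0 <= flat 1 t.
Proof. by rewrite /flat; case: ifP => // _; rewrite hornerC mul1r expR_ge0. Qed.

Lemma flat1_gt0 (R : realType) (t : R) : 0 < t -> 0 < flat 1 t.
Proof. by move=> t0; rewrite /flat t0 hornerC mul1r expR_gt0. Qed.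

Lemma flat_le0 (R : realType) (p : {poly R}) t : t <= 0 -> flat p t = 0.
Proof. by move=> t0; rewrite /flat ltNge t0. Qed.

(** * Cutoff functions and extension of germs to the whole space *)

Section Cutoff.
Context {R : realType} {d : nat}.
Implicit Types (O : set 'rV[R]_d) (x y : 'rV[R]_d).

(** Polynomials index the family closed under derivation, with p sent to X^2 (p - p'). *)
Lemma smooth_upto_flat k O (p : {poly R}) (f : 'rV[R]_d -> R^o) : open O ->
  smooth_upto k O f -> smooth_upto k O (fun y => flat p (f y) : R^o).
Proof. exact: smooth_upto_comp (@is_derive_flat R) k O f p. Qed.

(* [chi] is [flat 1 g / (flat 1 g + flat 1 (1 - g))] with [g = 2 - |y - x|^2 /
   (r/2)^2]: it is [1] where [1 <= g] and [0] where [g <= 0], and [0 <= g] forces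
   [y] into the sup-norm ball of radius [r] around [x]. *)
Lemma smooth_cutoff O x : open O -> O x ->
  exists (chi : 'rV[R]_d -> R^o) (U : set 'rV[R]_d),
    [/\ smooth_on setT chi, {near x, chi =1 fun=> 1}, open U,
        O `|` U = setT & forall y, U y -> chi y = 0].
Proof.
move=> Oo Ox.
have oT : open [set: 'rV[R]_d] by exact: openT.
have /nbhs_ballP[r /= r0 rO] : nbhs x O by exact: open_nbhs_nbhs.
pose g y : R^o := 2 - \sum_i (2 / r * (y 0 i - x 0 i)) ^+ 2.
have gS k : smooth_upto k setT g.
  have aff i : smooth_upto k setT (fun y => 2 / r * (y 0 i - x 0 i) : R^o).
    apply: (smooth_uptoM oT); first exact: smooth_upto_cst.
    apply: (smooth_uptoD oT); [exact: smooth_upto_coord|exact: smooth_upto_cst].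
  apply: (smooth_uptoD oT); first exact: smooth_upto_cst.
  apply: (smooth_uptoN oT).
  apply: (@smooth_upto_sum _ _ R^o k setT _ _ _
    (fun i y => (2 / r * (y 0 i - x 0 i)) ^+ 2) oT) => i _.
  exact: (smooth_uptoM oT (aff i) (aff i)).
have gc : continuous g by move=> y; have [+ _ _] := gS 1%N; exact.
pose F y : R^o := flat 1 (g y).
pose G y : R^o := flat 1 (1 - g y).
(* At least one of [g y] and [1 - g y] is positive, so the denominator never vanishes. *)
have FG0 y : F y + G y != 0.
  apply: lt0r_neq0; have [g0|g0] := ltP 0 (g y).
    by rewrite ltr_wpDr ?flat1_gt0 ?flat1_ge0.
  by rewrite ltr_wpDl ?flat1_gt0 ?flat1_ge0// subr_gt0; lra.
(* The strict inequality makes [U] open, so that derivatives vanish on it too; its complement lies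
   in the ball, hence in [O]. *)
exists (fun y => F y / (F y + G y)), [set y | g y < 0]; split.
- apply/smooth_onP => k.
  have FS : smooth_upto k setT F by exact: (smooth_upto_flat 1 oT (gS k)).
  have GS : smooth_upto k setT G.
    apply: (@smooth_upto_flat k setT 1 (fun y => 1 - g y) oT).
    apply: (smooth_uptoD oT); first exact: smooth_upto_cst.
    exact: (smooth_uptoN oT).
  exact: (smooth_uptoM oT FS
    (smooth_uptoV oT (fun y _ => FG0 y) (smooth_uptoD oT FS GS))).
- have gx : 1 < g x.
    rewrite /g big1 ?subr0 ?ltr1n// => i _.
    by rewrite subrr mulr0 expr0n.
  have : \forall y \near x, 1 < g y by exact: (gc x _ (lt_nbhsr gx)).
  apply: filterS => y gy /=.
  have G0 : G y = 0 by rewrite /G flat_le0// subr_le0 ltW.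
  by have := FG0 y; rewrite G0 addr0 => F0; rewrite divff.
- apply: (open_comp (f := g) (D := [set t | t < 0])); last exact: open_lt.
  by move=> y _; exact: gc.
- apply/seteqP; split => // y _ /=.
  have [gy|gy] := ltP (g y) 0; [by right|left].
  apply: rO; split => //= i j; rewrite (ord1 i).
  move: gy; rewrite subr_ge0 (bigD1 j)//= => gy.
  have {}gy : (2 / r * (y 0 j - x 0 j)) ^+ 2 <= 2.
    by apply: le_trans gy; rewrite lerDl sumr_ge0// => l _; exact: sqr_ge0.
  change (`|x 0 j - y 0 j| < r).
  (* Each coordinate of y - x is thus at most r / sqrt 2 in absolute value, which is less than r. *)
  have : (2 * (y 0 j - x 0 j)) ^+ 2 <= 2 * r ^+ 2.
    rewrite -ler_pdivrMr ?exprn_gt0//; apply: le_trans gy.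
    by rewrite -expr_div_n mulrAC.
  by move=> ?; rewrite ltr_norml; apply/andP; split; nra.
- by move=> y gy; rewrite /F flat_le0 ?mul0r// ltW.
Qed.

(** The product of [u] with the cutoff is smooth on [O] as a product and on [U] because it is zero
    there, whatever [u] is outside [O]; these two open sets cover the space. *)
Lemma smooth_extension O x m n (u : 'rV[R]_d -> 'M[R]_(m, n)) :
  open O -> O x -> smooth_on O u ->
  exists2 v : 'rV[R]_d -> 'M[R]_(m, n), smooth_on setT v & {near x, v =1 u}.
Proof.
move=> Oo Ox uO; have [chi [U [chiS chi1 Uo OU chi0]]] := smooth_cutoff Oo Ox.
exists (fun y => chi y *: u y); last first.
  by apply: filterS chi1 => y ->; rewrite scale1r.
have vO : smooth_on O (fun y => chi y *: u y).
  apply/smooth_onP => k; apply/smooth_upto_mxP => // a b.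
  have chiO : smooth_upto k O chi.
    by move: k; apply/smooth_onP => s y _; exact: chiS.
  rewrite (_ : (fun y => _) = fun y => chi y * u y a b : R^o); last first.
    by apply/funext => y; rewrite mxE.
  apply: smooth_uptoM => //; apply: (smooth_upto_mxP _ _ _).1 => //.
  by move: k {chiO}; apply/smooth_onP.
have vU : smooth_on U (fun y => chi y *: u y).
  apply/smooth_onP => k.
  apply: eq_smooth_upto (smooth_upto_cst k U (0 : 'M[R]_(m, n))) => // y.
  by rewrite inE => /chi0 ->; rewrite scale0r.
by move=> s y _; have [/vO|/vU] : (O `|` U) y by rewrite OU.
Qed.

End Cutoff.

(** * Locality and regularity of differential operators *)

Section DifferentialOperators.
Context {R : realType} {d n m : nat}.
Implicit Types (L : ldo R d n m) (O : set 'rV[R]_d) (x y : 'rV[R]_d)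
  (u v : 'rV[R]_d -> 'cV[R]_n).

(** Turns a multi-index into a list of directions, the form in which locality and smoothness are
    available. *)
Lemma partial_multiE (V : normedModType R) (alpha : 'I_d -> nat)
    (f : 'rV[R]_d -> V) :
  partial_multi alpha f =
  partials (flatten [seq nseq (alpha i) i | i <- enum 'I_d]) f.
Proof.
rewrite /partial_multi; elim: (enum _) => //= i s ->.
rewrite /partials foldr_cat.
by elim: (alpha i) => //= a ->.
Qed.

(** The conclusion holds near [x] and not just at [x], so that it can be iterated through
    compositions such as [B (Q u)]. *)
Lemma ldo_near L u v x : {near x, u =1 v} -> {near x, L u =1 L v}.
Proof.
move=> uv; suff near_eq y : {near y, u =1 v} -> L u y = L v y.
  by apply: filterS (near_join uv) => y; exact: near_eq.
move=> {}uv; rewrite /ldo_apply; apply: eq_bigr => alpha _; congr (_ *m _).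
rewrite !partial_multiE.
exact: nbhs_singleton (partials_near _ uv).
Qed.

(** By locality [u] may be replaced near [x] by the zero function, all of whose derivatives
    vanish. *)
Lemma ldo_eq0 L O u : open O -> (forall x, O x -> u x = 0) ->
  forall x, O x -> L u x = 0.
Proof.
move=> Oo u0 x Ox.
have : {near x, u =1 fun=> 0}.
  by apply: filterS (open_nbhs_nbhs (conj Oo Ox)) => y /u0.
move/(ldo_near L)/nbhs_singleton => /= ->.
have partials0 s : partials s (fun=> 0 : 'cV[R]_n) = fun=> 0.
  by elim: s => //= i s ->; apply/funext => y; exact: derive_cst.
by rewrite /ldo_apply big1// => a _; rewrite partial_multiE partials0 mulmx0.
Qed.

Lemma ldo_smooth_on L O u : open O -> smooth_on O u -> smooth_on O (L u).
Proof.
move=> Oo uO; apply/smooth_onP => k.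
apply: smooth_upto_sum => // alpha _.
apply/smooth_upto_mxP => // a b.
have cO : smooth_upto k O (ldo_coef alpha).
  by move: k; apply/smooth_onP => s y _; exact: ldo_coef_smooth.
have pO : smooth_upto k O (partial_multi (fun i => alpha i) u).
  (* An iterated derivative of a derivative of [u] is one of [u] itself, along the concatenated list
     of directions. *)
  move: k {cO}; apply/smooth_onP => s; rewrite partial_multiE /partials.
  by rewrite -foldr_cat; exact: uO.
rewrite (_ : (fun y => _) = fun y => \sum_c ldo_coef alpha y a c *
    partial_multi (fun i => alpha i) u y c b : R^o); last first.
  by apply/funext => y; rewrite mxE.
apply: smooth_upto_sum => // c _; apply: smooth_uptoM => //.
  exact: (smooth_upto_mxP _ _ _).1.
exact: (smooth_upto_mxP _ _ _).1.
Qed.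

End DifferentialOperators.

(** * Transfer of unique continuation from [B] to [A] *)

Theorem theorem3p19 (R : realType) (d n m p q : nat)
    (hd : (0 < d)%N) (hn : (0 < n)%N) (hm : (0 < m)%N)
    (hp : (0 < p)%N) (hq : (0 < q)%N)
    (A : ldo R d n m) (B : ldo R d p q) :
  pre_transmutation A B -> weak_ucp B -> weak_ucp A.
Proof.
move=> [P [Q [S [T [BQ PQ]]]]] ucpB O' O O'o O'0 Oo O0 OO' u uO' Au0 u0.
have BQu x : O' x -> B (Q u) x = 0.
  (* The extension [v] may depend on [x]: the identity is checked pointwise and only sees [v] near
     [x]. *)
  move=> O'x; have [v vS vu] := smooth_extension O'o O'x uO'.
  have <- := nbhs_singleton (ldo_near B (ldo_near Q vu)).
  rewrite BQ// (nbhs_singleton (ldo_near S (ldo_near A vu))).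
  exact: (ldo_eq0 S O'o Au0).
have Qu : forall x, O' x -> Q u x = 0.
  apply: (ucpB O' O) => //; first exact: ldo_smooth_on.
  exact: (ldo_eq0 Q Oo u0).
move=> x O'x; have [v vS vu] := smooth_extension O'o O'x uO'.
have <- := nbhs_singleton vu; rewrite -PQ//.
rewrite (nbhs_singleton (ldo_near P (ldo_near Q vu))).
rewrite (nbhs_singleton (ldo_near T (ldo_near A vu))).
by rewrite (ldo_eq0 P O'o Qu)// (ldo_eq0 T O'o Au0)// addr0.
Qed.
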